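(* Let $d$ be a positive integer. For any $4$-design POVM $\pi_y$ on a $d$-dimensional complex Hilbert space, the informational power satisfies $W(\pi_y)\le W_4(d)$, where $$W_4(d) := \frac12 \ln \frac{6d^2}{(d+2)(d+3)} + \frac{(d-3)\sqrt{3d(d+2)}}{6d(d+1)} \ln \frac{2d+3-\sqrt{3d(d+2)}}{d+3}.$$
   Context: Let $\mathcal{H}$ be a $d$-dimensional complex Hilbert space. A state is a positive semidefinite operator $\rho$ on $\mathcal{H}$ with $\operatorname{Tr}[\rho]\le 1$; an effect is a positive semidefinite operator $\pi \le \mathbb{1}_d$. An ensemble is a measurable function $x\mapsto\rho_x$ from the reals to states with $\int \operatorname{Tr}[\rho_x]\,dx = 1$. A POVM is a measurable function $y\mapsto\pi_y$ from the reals to effects with $\int \pi_y\,dy = \mathbb{1}_d$. Finite ensembles and finite POVMs are included (sums in place of integrals, or equivalently step functions). A POVM $\pi_y$ is a $t$-design POVM if the ensemble $\pi_y/d$ is a spherical quantum $t$-design, i.e. for every integer $1\le k\le t$, $\int \frac{\pi_y^{\otimes k}}{\operatorname{Tr}[\pi_y]^{k-1}}\,dy = d\binom{d-1+k}{k}^{-1} P_{\mathrm{sym}}$, where $P_{\mathrm{sym}}$ is the orthogonal projector onto the symmetric subspace of $\mathcal{H}^{\otimes k}$ (the right-hand side is $d$ times the corresponding average over pure states distributed with the uniform (Haar) measure on the unit sphere); the integrand is $0$ where $\pi_y=0$. For an ensemble $\rho_x$ and a POVM $\pi_y$, let $p_{x,y}=\operatorname{Tr}[\rho_x\pi_y]$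 with marginals $p_x,p_y$; the mutual information is $I(\rho_x,\pi_y) := \iint p_{x,y}\ln\frac{p_{x,y}}{p_xp_y}\,dx\,dy$ (with $0\ln 0=0$). The informational power is $W(\pi_y) := \sup_{\rho_x} I(\rho_x,\pi_y)$, the supremum being over all ensembles. *)

(* Defs.v *)
From HB Require Import structures.
From mathcomp Require Import all_boot all_order all_algebra all_fingroup.
From mathcomp Require Import sesquilinear spectral complex.
From mathcomp Require Import all_classical all_reals all_analysis.

Set Implicit Arguments.
Unset Strict Implicit.
Unset Printing Implicit Defensive.

Import Order.TTheory GRing.Theory Num.Theory.
Import numFieldNormedType.Exports.

Local Open Scope classical_set_scope.
Local Open Scope ring_scope.
Local Open Scope complex_scope.
Local Open Scope sesquilinear_scope.

(* The Hilbert space of dimension d is C^d with its standard inner product;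
   operators on it are matrices over C = R[i]. *)

(* On R[i], [0 <= z] means that z is real and nonnegative, so that psdmx A
   forces A to be Hermitian. *)
Definition psdmx {R : realType} {n : nat} (A : 'M[R[i]]_n) : Prop :=
  forall v : 'cV[R[i]]_n, 0 <= (v ^t* *m A *m v) 0 0.

Definition is_state {R : realType} {d : nat} (A : 'M[R[i]]_d) : Prop :=
  psdmx A /\ \tr A <= 1.

Definition is_effect {R : realType} {d : nat} (A : 'M[R[i]]_d) : Prop :=
  psdmx A /\ psdmx (1%:M - A).

Definition measurable_mx {R : realType} {m n : nat}
    (F : measurableTypeR R -> 'M[R[i]]_(m, n)) : Prop :=
  forall i j, measurable_fun setT (fun x => complex.Re (F x i j)) /\
              measurable_fun setT (fun x => complex.Im (F x i j)).

(* F is integrable over the real line, and its (entrywise) integral is M. *)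
Definition has_mx_integral {R : realType} {m n : nat}
    (F : measurableTypeR R -> 'M[R[i]]_(m, n)) (M : 'M[R[i]]_(m, n)) : Prop :=
  forall i j,
    [/\ lebesgue_measure.-integrable setT
          (fun x => (complex.Re (F x i j))%:E),
        lebesgue_measure.-integrable setT
          (fun x => (complex.Im (F x i j))%:E) &
        M i j = Rintegral lebesgue_measure setT (fun x => complex.Re (F x i j))
             +i* Rintegral lebesgue_measure setT (fun x => complex.Im (F x i j))].

(* A finite family of states or effects is the case of a step function that is
   constant on finitely many intervals of length one and zero elsewhere. *)
Definition is_ensemble {R : realType} {d : nat}
    (rho : measurableTypeR R -> 'M[R[i]]_d) : Prop :=
  [/\ measurable_mx rho,
      forall x, is_state (rho x) &
      (\int[lebesgue_measure]_x (complex.Re (\tr (rho x)))%:E = 1)%E].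

Definition is_povm {R : realType} {d : nat}
    (pi : measurableTypeR R -> 'M[R[i]]_d) : Prop :=
  [/\ measurable_mx pi,
      forall y, is_effect (pi y) &
      has_mx_integral pi 1%:M].

(* The k-th tensor power of C^d has the product basis e_(f 0) (x) ... (x)
   e_(f (k-1)) indexed by the functions f : 'I_k -> 'I_d. *)
Notation tens_dim k d := #|{: {ffun 'I_k -> 'I_d}}|.

Definition tens_idx {k d : nat} (a : 'I_(tens_dim k d)) : {ffun 'I_k -> 'I_d} :=
  enum_val a.

Definition tens_powmx {C : comPzRingType} {d : nat} (k : nat) (A : 'M[C]_d) :
    'M[C]_(tens_dim k d) :=
  \matrix_(a, b) \prod_(i < k) A (tens_idx a i) (tens_idx b i).

(* Permutation of the k tensor factors by s. *)
Definition tens_permmx {C : pzRingType} (k d : nat) (s : 'S_k) :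
    'M[C]_(tens_dim k d) :=
  \matrix_(a, b) (tens_idx b == [ffun i => tens_idx a (s i)])%:R.

(* As the row space of a matrix: the tensors fixed by all the permutations of
   the factors. *)
Definition sym_space {C : fieldType} (k d : nat) : 'M[C]_(tens_dim k d) :=
  (\bigcap_(s : 'S_k) eigenspace (tens_permmx d s) 1)%MS.

(* proj_ortho acts on row vectors; the symmetric subspace being spanned by real
   vectors, this projector is a symmetric matrix, so it is also the orthogonal
   projector for the action on column vectors. *)
Definition Psym {C : numClosedFieldType} (k d : nat) : 'M[C]_(tens_dim k d) :=
  proj_ortho (sym_space k d).

(* As 0^-1 = 0, the integrand vanishes where pi y = 0. *)
Definition is_design_povm {R : realType} {d : nat} (t : nat)
    (pi : measurableTypeR R -> 'M[R[i]]_d) : Prop :=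
  is_povm pi /\
  forall k : nat, (1 <= k <= t)%N ->
    has_mx_integral
      (fun y => (\tr (pi y) ^+ k.-1)^-1 *: tens_powmx k (pi y))
      ((d%:R / 'C(d.-1 + k, k)%:R) *: Psym k d).

Definition joint_prob {R : realType} {d : nat}
    (rho pi : measurableTypeR R -> 'M[R[i]]_d)
    (x y : measurableTypeR R) : R :=
  complex.Re (\tr (rho x *m pi y)).

Definition marginal_x {R : realType} {d : nat}
    (rho pi : measurableTypeR R -> 'M[R[i]]_d) (x : measurableTypeR R) : R :=
  Rintegral lebesgue_measure setT (fun y => joint_prob rho pi x y).

Definition marginal_y {R : realType} {d : nat}
    (rho pi : measurableTypeR R -> 'M[R[i]]_d) (y : measurableTypeR R) : R :=
  Rintegral lebesgue_measure setT (fun x => joint_prob rho pi x y).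

(* The negative part of the integrand is integrable, so the extended-real
   integral is meaningful; where p = 0 the integrand is 0. *)
Definition mutual_information {R : realType} {d : nat}
    (rho pi : measurableTypeR R -> 'M[R[i]]_d) : \bar R :=
  (\int[lebesgue_measure \x lebesgue_measure]_z
    (let p := joint_prob rho pi z.1 z.2 in
     p * ln (p / (marginal_x rho pi z.1 * marginal_y rho pi z.2)))%R%:E)%E.

Definition informational_power {R : realType} {d : nat}
    (pi : measurableTypeR R -> 'M[R[i]]_d) : \bar R :=
  ereal_sup [set mutual_information rho pi | rho in
    [set rho : measurableTypeR R -> 'M[R[i]]_d | is_ensemble rho]].

Definition W4 (R : realType) (d : nat) : R :=
  let D : R := d%:R in
  let r : R := Num.sqrt (3 * D * (D + 2)) in
  2^-1 * ln (6 * D ^+ 2 / ((D + 2) * (D + 3)))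
  + (D - 3) * r / (6 * D * (D + 1)) * ln ((2 * D + 3 - r) / (D + 3)).

(* Main.v *)
Require Import Defs.
From mathcomp Require Import all_boot all_order all_algebra all_fingroup complex.
From mathcomp Require Import sesquilinear spectral.
From mathcomp Require Import all_classical all_reals all_analysis.
From mathcomp Require Import measurable_realfun ring lra.

(* Let q_y = Tr pi_y / d. Gibbs' inequality bounds I(rho, pi) by the integral of
   p_(x,y) ln (p_(x,y) / (p_x q_y)), whose inner integral depends on one state
   rho_x only. By the log-sum inequality it suffices to bound it for pure states
   |v><v|: with t_y = <v|pi_y|v> / Tr pi_y, it is the mean of ln (d t_y) for the
   probability density t_y Tr pi_y, and the 4-design property says that the
   moments of t_y up to degree 3 are those of the Beta(2, d - 1) distribution
   (the point mass at 1 if d = 1).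
   Replacing ln by its cubic Hermite interpolant at the two Gauss nodes of that
   distribution, which lies above ln because the fourth derivative of ln is
   negative, gives W4 exactly. *)

Set Implicit Arguments.
Unset Strict Implicit.
Unset Printing Implicit Defensive.

Import Order.TTheory GRing.Theory Num.Theory.
Import numFieldNormedType.Exports.

Local Open Scope classical_set_scope.
Local Open Scope ring_scope.
Local Open Scope complex_scope.
Local Open Scope sesquilinear_scope.

Local Notation qform B v := ((v ^t* *m B *m v) 0 0).

(** * Cubic upper bounds for the logarithm *)

Lemma ln_le_subr1 (R : realType) (x : R) : 0 < x -> ln x <= x - 1.
Proof.
move=> x0; rewrite -[X in ln X](subrKC 1); apply: le_ln1Dx.
by rewrite ltrBrDl subrr.
Qed.

(** Only the chord [a + b * t] is pinned down: the quadratic factor vanishes at both nodes, and its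
    product with an affine function has mean 0 once these are Gauss nodes, so that [c] and [e] drop
    out of the mean. *)
Lemma ln_le_hermite (R : realType) (t1 t2 : R) : 0 < t1 -> t1 < t2 ->
  exists a b c e : R, [/\ ln t1 = a + b * t1, ln t2 = a + b * t2 &
    forall t, 0 < t -> ln t <= a + b * t + (t - t1) * (t - t2) * (c + e * t)].
Proof.
move=> t10 t12; have t20 : 0 < t2 by exact: lt_trans t12.
have t21 : t2 - t1 != 0 by rewrite subr_eq0 gt_eqF.
pose b := (ln t2 - ln t1) / (t2 - t1).
pose a := ln t1 - b * t1.
(* Tangency to [ln] at [t1] and [t2] forces [c + e * t] to take the values [u1] and [u2] there. *)
pose u1 := (t1^-1 - b) / (t1 - t2).
pose u2 := (t2^-1 - b) / (t2 - t1).
pose e := (u2 - u1) / (t2 - t1).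
pose c := u1 - e * t1.
exists a, b, c, e.
have E1 : ln t1 = a + b * t1 by rewrite /a subrK.
have E2 : ln t2 = a + b * t2.
  have : b * (t2 - t1) = ln t2 - ln t1 by rewrite /b divfK.
  by rewrite E1 /a; lra.
split=> //.
pose g (t : R) := a + b * t + (t - t1) * (t - t2) * (c + e * t) - ln t.
pose N (t : R) :=
  t * (b + ((t - t1) + (t - t2)) * (c + e * t) + (t - t1) * (t - t2) * e) - 1.
have dg (t : R) : 0 < t -> is_derive t (1 : R) g (N t / t).
  move=> t0; rewrite /g.
  have Dln := is_derive1_ln t0.
  apply: is_derive_eq; rewrite /GRing.scale /= /N.
  by field; rewrite gt_eqF.
have cg (s t : R) : 0 < s -> {within `[s, t], continuous g}.
  move=> s0; apply: derivable_within_continuous => x.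
  rewrite in_itv /= => /andP[sx _].
  by have [] := dg x (lt_le_trans s0 sx).
have mvt (s t : R) : 0 < s -> s < t ->
    exists2 x, s < x < t & g t - g s = N x / x * (t - s).
  move=> s0 st.
  have [x|x] := @MVT _ g (fun x => N x / x) s t st _ (cg s t s0).
    by rewrite in_itv /= => /andP[sx _]; apply: dg; exact: lt_trans sx.
  by rewrite in_itv /= => xst E; exists x.
have g1 : g t1 = 0 by rewrite /g E1; ring.
have g2 : g t2 = 0 by rewrite /g E2; ring.
(* N is cubic with N 0 = -1 and vanishes at t1, t2 and, by Rolle's theorem, at
   some xi in between, which determines the sign of g' = N t / t. *)
have NE t : N t = (t - t1) * (t - t2) * (3 * e * t - (t1 * t2)^-1).
  rewrite /N /c /e /u1 /u2 /b; move: t21; generalize (ln t2) (ln t1) => l2 l1 t21.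
  by field; rewrite t21 -(opprB t2) oppr_eq0 t21 !gt_eqF.
have [xi /andP[xi1 xi2] /eqP] := mvt t1 t2 t10 t12.
rewrite g1 g2 subrr eq_sym !mulf_eq0 invr_eq0 NE !mulf_eq0 !subr_eq0.
rewrite (gt_eqF xi1) (lt_eqF xi2) (gt_eqF t12) (gt_eqF (lt_trans t10 xi1)) !orbF /=.
move=> /eqP Exi.
have xi0 : 0 < xi := lt_trans t10 xi1.
have {}NE t : N t = (t1 * t2 * xi)^-1 * ((t - t1) * (t - t2) * (t - xi)).
  rewrite NE; have -> : 3 * e = (t1 * t2)^-1 / xi.
    by apply: (mulIf (lt0r_neq0 xi0)); rewrite divfK ?gt_eqF //; lra.
  by field; rewrite !gt_eqF.
move=> t t0; rewrite -subr_ge0 -/(g t).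
have [->|tt1] := eqVneq t t1; first by rewrite g1.
have [->|tt2] := eqVneq t t2; first by rewrite g2.
have sgN x : 0 < x -> (0 <= N x / x) = (0 <= (x - t1) * (x - t2) * (x - xi)).
  by move=> x0; rewrite pmulr_lge0 ?invr_gt0// NE pmulr_rge0// invr_gt0 !mulr_gt0.
have sgN' x : 0 < x -> (N x / x <= 0) = ((x - t1) * (x - t2) * (x - xi) <= 0).
  by move=> x0; rewrite pmulr_lle0 ?invr_gt0// NE pmulr_rle0// invr_gt0 !mulr_gt0.
have step s x r : 0 < x -> (s < x < r) -> g r - g s = N x / x * (r - s) ->
    (0 <= (x - t1) * (x - t2) * (x - xi) -> g s <= g r) /\
    ((x - t1) * (x - t2) * (x - xi) <= 0 -> g r <= g s).
  move=> x0 /andP[sx xr] E; have rs : 0 < r - s by rewrite subr_gt0 (lt_trans sx).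
  by split=> h; rewrite -subr_ge0 -?(opprB (g r)) E ?oppr_ge0
    ?(pmulr_lge0 _ rs) ?(pmulr_lle0 _ rs) ?sgN ?sgN'.
(* The error [g] decreases up to [t1], increases up to [xi], decreases up to [t2] and then
   increases, so its zeros at [t1] and [t2] are minima; each case compares [t] with the node on its
   own side of [xi]. *)
have [tlt1|t1lt] := ltP t t1.
  have [x xin E] := mvt _ _ t0 tlt1; case/andP: (xin) => tx xt1.
  rewrite -g1; apply: (step _ _ _ (lt_trans t0 tx) xin E).2.
  apply: mulr_ge0_le0; last lra.
  by apply: mulr_le0; lra.
have {}t1lt : t1 < t by rewrite lt_def tt1.
have [tlxi|xilt] := ltP t xi.
  have [x xin E] := mvt _ _ t10 t1lt; case/andP: (xin) => tx xt.
  rewrite -g1; apply: (step _ _ _ (lt_trans t10 tx) xin E).1.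
  apply: mulr_le0; last lra.
  by apply: mulr_ge0_le0; lra.
have [tlt2|t2lt] := ltP t t2.
  have [x xin E] := mvt _ _ t0 tlt2; case/andP: (xin) => tx xt2.
  rewrite -g2; apply: (step _ _ _ (lt_trans t0 tx) xin E).2.
  apply: mulr_le0_ge0; last lra.
  by apply: mulr_ge0_le0; lra.
have {}t2lt : t2 < t by rewrite lt_def tt2.
have [x xin E] := mvt _ _ t20 t2lt; case/andP: (xin) => tx xt.
rewrite -g2; apply: (step _ _ _ (lt_trans t20 tx) xin E).1.
by rewrite !mulr_ge0//; lra.
Qed.

Lemma mulr_fact_bin (R : numDomainType) (n k : nat) :
  k`!%:R * 'C(n + k, k)%:R = \prod_(i < k) (n + k - i)%:R :> R.
Proof.
by rewrite -natrM mulnC bin_ffact ffact_prod natr_prod.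
Qed.

(** The degree in the weight is shifted by one: for a unit vector, the design moment of degree
    [k.+1] is the [k]-th moment of t_y for the density t_y Tr pi_y. Hence degree 3 is the highest
    that a 4-design controls. *)
Lemma ln_le_cubic (R : realType) (d : nat) : (0 < d)%N ->
  exists h : 'I_4 -> R,
    (forall t, 0 < t -> ln (d%:R * t) <= \sum_(k < 4) h k * t ^+ k) /\
    \sum_(k < 4) h k * (d%:R / 'C(d.-1 + k.+1, k.+1)%:R) = W4 R d.
Proof.
case: d => // n _ /=; rewrite /W4; set D : R := n.+1%:R.
have D1 : 1 <= D by rewrite /D ler1n.
have D0 : 0 < D by lra.
set r := Num.sqrt _.
have r2 : r ^+ 2 = 3 * D * (D + 2) by rewrite sqr_sqrtr// !mulr_ge0//; lra.
have r0 : 0 < r by rewrite sqrtr_gt0 !mulr_gt0//; lra.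
have rlt : r < 3 * (D + 2).
  rewrite -ltr_sqr ?nnegrE ?(ltW r0)//; last lra.
  by rewrite r2; nra.
(* The roots of t^2 - 6 / (D + 3) t + 6 / ((D + 2) (D + 3)), which is orthogonal
   to polynomials of degree at most 1 for Beta(2, D - 1). *)
pose t1 := (3 * (D + 2) - r) / ((D + 2) * (D + 3)).
pose t2 := (3 * (D + 2) + r) / ((D + 2) * (D + 3)).
have K0 : 0 < (D + 2) * (D + 3) by rewrite mulr_gt0//; lra.
have t10 : 0 < t1 by rewrite divr_gt0// subr_gt0.
have t12 : t1 < t2 by rewrite ltr_pM2r ?invr_gt0//; lra.
have t20 := lt_trans t10 t12.
have [a [b [c [e [E1 E2 H]]]]] := ln_le_hermite t10 t12.
have St : t1 + t2 = 6 / (D + 3).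
  by rewrite /t1 /t2; field; apply/andP; split; rewrite gt_eqF//; lra.
have Pt : t1 * t2 = 6 / ((D + 2) * (D + 3)).
  have -> : t1 * t2 = (9 * (D + 2) ^+ 2 - r ^+ 2) / ((D + 2) * (D + 3)) ^+ 2.
    by rewrite /t1 /t2; field; apply/andP; split; rewrite gt_eqF//; lra.
  by rewrite r2; field; apply/andP; split; rewrite gt_eqF//; lra.
pose s := t1 + t2; pose p := t1 * t2.
(* Coefficients of [ln D + a + b * t + (t ^+ 2 - s * t + p) * (c + e * t)] by increasing degree;
   [ln D] comes from [ln (D * t)]. *)
exists (fun k : 'I_4 => [:: ln D + a + p * c; b - s * c + p * e; c - s * e; e]`_k).
split=> [t t0|].
  rewrite !big_ord_recl big_ord0 /= lnM ?posrE//.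
  rewrite /bump /= expr0 expr1 mulr1.
  have := H t t0; rewrite /s /p.
  have -> : (t - t1) * (t - t2) = t ^+ 2 - (t1 + t2) * t + t1 * t2 by ring.
  rewrite !exprS expr0. lra.
(* Falling factorials turn the binomial coefficients into polynomials in [D], as [field]
   requires. *)
have B k : 'C(n + k, k)%:R = (\prod_(i < k) (n + k - i)%:R) / k`!%:R :> R.
  by rewrite -mulr_fact_bin mulrC mulKf// pnatr_eq0 -lt0n fact_gt0.
rewrite !big_ord_recl big_ord0 /= /bump /=.
rewrite !B !big_ord_recl !big_ord0 /= /bump /= !factS fact0.
rewrite !addnS !addn0 !subn0 !subSS !subn0.
have -> : n.+4%:R = D + 3 :> R by rewrite /D -[in RHS](natrD _ _ 3) addn3.
have -> : n.+3%:R = D + 2 :> R by rewrite /D -[in RHS](natrD _ _ 2) addn2.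
have -> : n.+2%:R = D + 1 :> R by rewrite /D -[in RHS](natrD _ _ 1) addn1.
rewrite -/D.
(* Both logarithms of [W4] are rewritten through the nodes. This exhibits [W4] as [ln D] plus the
   Gauss quadrature of [ln], with weights 1/2 + w at [t1] and 1/2 - w at [t2], where w is the
   coefficient of the second logarithm. *)
have -> : 6 * D ^+ 2 / ((D + 2) * (D + 3)) = D ^+ 2 * (t1 * t2).
  by rewrite Pt; field; apply/andP; split; rewrite gt_eqF//; lra.
have -> : (2 * D + 3 - r) / (D + 3) = t1 / t2.
  apply: (mulIf (lt0r_neq0 t20)); rewrite divfK ?gt_eqF//.
  rewrite /t1 /t2.
  have -> : (2 * D + 3 - r) / (D + 3) * ((3 * (D + 2) + r) / ((D + 2) * (D + 3))) =
     ((2 * D + 3) * (3 * (D + 2)) + (2 * D + 3) * r - 3 * (D + 2) * r - r ^+ 2)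
     / ((D + 2) * (D + 3) ^+ 2).
    by field; apply/andP; split; rewrite gt_eqF//; lra.
  by rewrite r2; field; apply/andP; split; rewrite gt_eqF//; lra.
have -> : ln (D ^+ 2 * (t1 * t2)) = 2 * ln D + (ln t1 + ln t2).
  have D2 : 0 < D ^+ 2 by rewrite exprn_gt0.
  have t12_gt0 : 0 < t1 * t2 by rewrite mulr_gt0.
  have lnD2 : ln (D ^+ 2) = ln D *+ 2 := lnXn 2 D0.
  by rewrite (lnM D2 t12_gt0) (lnM t10 t20) lnD2 mulr_natl.
rewrite ln_div ?posrE//.
rewrite E1 E2 {}/s {}/p St Pt.
have -> : a + b * t1 - (a + b * t2) = - 2 * b * r / ((D + 2) * (D + 3)).
  by rewrite /t1 /t2; field; apply/andP; split; rewrite gt_eqF//; lra.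
have -> : a + b * t1 + (a + b * t2) = 2 * a + b * (6 / (D + 3)) by rewrite -St; ring.
(* The factor [r] of the weight meets the [r] of the node spacing, so only [r ^+ 2], a polynomial in
   [D], remains. *)
have -> : (D - 3) * r / (6 * D * (D + 1)) * (- 2 * b * r / ((D + 2) * (D + 3)))
   = - (D - 3) * b / (3 * D * (D + 1) * ((D + 2) * (D + 3))) * r ^+ 2.
  by field; do ?[apply/andP; split]; rewrite gt_eqF//; lra.
rewrite r2.
move: (ln D) => l.
by field; do ?[apply/andP; split]; rewrite gt_eqF//; lra.
Qed.

(** * Pointwise inequalities for relative entropy densities *)

Lemma mul_ln_ge_subr (R : realType) (x y : R) : 0 <= x -> 0 < y ->
  x - y <= x * ln (x / y).
Proof.
rewrite le_eqVlt => /predU1P[<- y0|x0 y0]; first by rewrite mul0r sub0r oppr_le0 ltW.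
rewrite -[x / y]invrK invf_div lnV ?posrE ?divr_gt0// mulrN -opprB lerN2.
rewrite (le_trans (ler_wpM2l (ltW x0) (ln_le_subr1 (divr_gt0 y0 x0))))//.
by rewrite mulrBr mulrCA divff ?gt_eqF// !mulr1.
Qed.

(** This lower bound and [mul_ln_le] together dominate the absolute value of x ln (x / y) by y + |ln
    C| x, which yields integrability. For [y = 0] both sides are 0, as [0^-1 = 0] and [ln 0 = 0]. *)
Lemma mul_ln_ge (R : realType) (x y : R) : 0 <= x -> 0 <= y ->
  - y <= x * ln (x / y).
Proof.
move=> x0; rewrite le_eqVlt => /predU1P[<-|y0].
  by rewrite oppr0 invr0 mulr0 ln0 ?mulr0.
by rewrite (le_trans _ (mul_ln_ge_subr x0 y0))// lerDr.
Qed.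

Lemma mul_ln_le (R : realType) (C x y : R) : 0 <= x -> 0 <= y ->
  x <= C * y -> x * ln (x / y) <= x * `|ln C|.
Proof.
rewrite le_eqVlt => /predU1P[<-|x0]; first by rewrite !mul0r.
rewrite le_eqVlt => /predU1P[<-|y0 xC]; first by rewrite mulr0 leNgt x0.
rewrite ler_pM2l// (le_trans _ (ler_norm _))//.
have xyC : x / y <= C by rewrite ler_pdivrMr.
by rewrite ler_ln ?posrE ?(lt_le_trans _ xyC)// divr_gt0.
Qed.

(* The last term accounts for the junk value p / 0 = 0 where py = 0; it vanishes
   almost everywhere once py is the marginal of p. *)
Lemma mul_ln_change (R : realType) (p px py q C : R) :
  0 <= p -> 0 <= px -> 0 <= py -> 0 <= q -> p <= C * (px * q) ->
  p * ln (p / (px * py)) <= p * ln (p / (px * q)) + (p * (q / py) - p) +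
    (p - p * ln (p / (px * q))) * (py == 0)%:R.
Proof.
move=> + px0 + q0; rewrite le_eqVlt => /predU1P[<-|p0].
  by rewrite !mul0r !subr0 !mul0r !addr0.
rewrite le_eqVlt => /predU1P[<- _|py0 pC].
  by rewrite mulr0 invr0 !mulr0 ln0// eqxx mulr0 mulr1; lra.
rewrite (gt_eqF py0) mulr0 addr0.
(* The bound [pC] acts as absolute continuity: [p > 0] forces [px > 0] and [q > 0], so the logarithm
   splits and ln u <= u - 1 applies to u = q / py. *)
have pxq : px * q != 0 by apply: contraTneq pC => ->; rewrite mulr0 -ltNge.
have {}px0 : 0 < px.
  by rewrite lt_def px0 andbT; apply: contraNneq pxq => ->; rewrite mul0r.
have {}q0 : 0 < q.
  by rewrite lt_def q0 andbT; apply: contraNneq pxq => ->; rewrite mulr0.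
have -> : p / (px * py) = p / (px * q) * (q / py).
  by field; rewrite !gt_eqF.
rewrite lnM ?posrE ?divr_gt0 ?mulr_gt0// mulrDr lerD2l.
rewrite -[X in _ - X](mulr1 p) -mulrBr ler_pM2l// .
by apply: ln_le_subr1; rewrite divr_gt0.
Qed.

(** Each [a i] is compared with its proportional share b_i S / B of the total through
    [mul_ln_ge_subr]; the resulting corrections sum to 0. Applied to the rank-one components of a
    state, this reduces the bound to pure states. *)
Lemma log_sum (R : realType) (I : finType) (a b : I -> R) (q : R) :
  (forall i, 0 <= a i) -> (forall i, 0 <= b i) -> 0 <= q ->
  (forall i, b i = 0 -> a i = 0) ->
  (\sum_i a i) * ln ((\sum_i a i) / ((\sum_i b i) * q)) <=
  \sum_i a i * ln (a i / (b i * q)).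
Proof.
move=> a0 b0; rewrite le_eqVlt => /predU1P[<- _|q0 ab].
  by rewrite mulr0 invr0 mulr0 ln0// mulr0 big1// => i _;
    rewrite mulr0 invr0 mulr0 ln0// mulr0.
set S := \sum_i a i; set B := \sum_i b i.
have S0 : 0 <= S by apply: sumr_ge0.
have [S_eq0|S_neq0] := eqVneq S 0.
  rewrite S_eq0 mul0r sumr_ge0// => i _.
  suff -> : a i = 0 by rewrite mul0r.
  apply/eqP; move/eqP: S_eq0; rewrite psumr_eq0// => /allP; apply.
  by rewrite mem_index_enum.
have {}S0 : 0 < S by rewrite lt_def S_neq0.
have B0 : 0 < B.
  rewrite lt_def sumr_ge0// andbT; apply: contraNneq S_neq0 => /eqP.
  rewrite psumr_eq0// => /allP bz; apply/eqP/big1 => i _; apply/ab/eqP.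
  by apply: bz; rewrite mem_index_enum.
have h i : a i * ln (S / (B * q)) + (a i - b i * S / B) <= a i * ln (a i / (b i * q)).
  have := b0 i; rewrite le_eqVlt => /predU1P[bi|bi].
    by rewrite ab// -bi !mul0r subr0 addr0.
  have y0 : 0 < b i * S / B by rewrite !mulr_gt0// invr_gt0.
  have := a0 i; rewrite le_eqVlt => /predU1P[<-|ai].
    by rewrite !mul0r add0r sub0r oppr_le0 ltW.
  have -> : a i / (b i * q) = S / (B * q) * (a i / (b i * S / B)).
    by field; rewrite !gt_eqF.
  rewrite [in leRHS]lnM ?posrE ?divr_gt0 ?mulr_gt0// mulrDr lerD2l.
  by rewrite mul_ln_ge_subr// ltW.
apply: le_trans (ler_sum _ (fun i _ => h i)).
rewrite big_split /= -mulr_suml lerDl -/S big_split /= sumrN -/S.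
by rewrite -!mulr_suml -/B mulrAC divff ?gt_eqF// mul1r subrr.
Qed.

(** * Integration and Gibbs' inequality on product spaces *)

Lemma le_integral_measurable d (T : measurableType d) (R : realType)
    (mu : {measure set T -> \bar R}) (f g : T -> \bar R) :
  measurable_fun [set: T] f -> measurable_fun [set: T] g ->
  (forall x, f x <= g x)%E ->
  (\int[mu]_x f x <= \int[mu]_x g x)%E.
Proof.
(* Positive parts are compared upwards and negative parts downwards, so that infinite integrals are
   covered as well. *)
move=> mf mg fg; rewrite integralE [leRHS]integralE leeB//.
- apply: ge0_le_integral => //; [exact: measurable_funepos..|].
  by move=> x _; apply: (@funepos_le _ _ setT) => [y _|]; rewrite ?in_setT.
- apply: ge0_le_integral => //; [exact: measurable_funeneg..|].
  by move=> x _; apply: (@funeneg_le _ _ setT) => [y _|]; rewrite ?in_setT.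
Qed.

Lemma measurable_inv (R : realType) : measurable_fun setT (@GRing.inv R).
Proof.
(* The point 0, where the inverse takes a default value, is split off; elsewhere inversion is
   continuous. *)
have -> : [set: R] = [set 0] `|` ~` [set 0] by rewrite setUv.
apply/measurable_funU; [exact: measurable_set1| |split].
- by apply: measurableC; exact: measurable_set1.
- exact: measurable_fun_set1.
- apply: subspace_continuous_measurable_fun.
    by apply: measurableC; exact: measurable_set1.
  rewrite continuous_open_subspace; last exact/closed_openC/closed_eq.
  by move=> x; rewrite inE => /eqP; exact: inv_continuous.
Qed.

Lemma measurable_mul_ln (R : realType) d (T : measurableType d) (f g : T -> R) :
  measurable_fun [set: T] f -> measurable_fun [set: T] g ->
  measurable_fun [set: T] (fun x => f x * ln (f x / g x)).
Proof.
move=> mf mg; apply: measurable_funM => //; apply: measurableT_comp => //.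
apply: measurable_funM => //; apply: measurableT_comp => //.
exact: measurable_inv.
Qed.

(** Integrating [mul_ln_change] replaces the marginal [py] by the density [q]: the correction p q /
    py - p has integral at most 1 - 1 = 0. The bound with [C] makes the new integrand integrable,
    and Fubini's theorem then reduces the claim to single values of x, where the last hypothesis
    applies. *)
Lemma mutual_information_le d1 d2 (X : measurableType d1)
    (Y : measurableType d2) (R : realType)
    (mu : {sigma_finite_measure set X -> \bar R})
    (nu : {sigma_finite_measure set Y -> \bar R})
    (p : X * Y -> R) (px : X -> R) (py q : Y -> R) (C W : R) :
  measurable_fun [set: X * Y] p -> measurable_fun [set: X] px ->
  measurable_fun [set: Y] py -> measurable_fun [set: Y] q ->
  (forall z, 0 <= p z) -> (forall y, 0 <= q y) ->
  (\int[mu]_x (px x)%:E = 1)%E -> (\int[nu]_y (q y)%:E = 1)%E ->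
  (forall x, \int[nu]_y (p (x, y))%:E = (px x)%:E)%E ->
  (forall y, \int[mu]_x (p (x, y))%:E = (py y)%:E)%E ->
  (forall x y, p (x, y) <= C * (px x * q y)) ->
  (forall x, \int[nu]_y (p (x, y) * ln (p (x, y) / (px x * q y)))%:E
             <= (px x * W)%:E)%E ->
  (\int[mu \x nu]_z (p z * ln (p z / (px z.1 * py z.2)))%:E <= W%:E)%E.
Proof.
move=> mp mpx mpy mq p0 q0 px1 q1 ipx ipy pC hW.
have px0 x : 0 <= px x.
  by rewrite -lee_fin -ipx; apply: integral_ge0 => y _; rewrite lee_fin.
have py0 y : 0 <= py y.
  by rewrite -lee_fin -ipy; apply: integral_ge0 => x _; rewrite lee_fin.
have m1 (f : X -> R) : measurable_fun [set: X] f ->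
    measurable_fun [set: X * Y] (fun z => f z.1).
  by move=> mf; apply: measurableT_comp.
have m2 (f : Y -> R) : measurable_fun [set: Y] f ->
    measurable_fun [set: X * Y] (fun z => f z.2).
  by move=> mf; apply: measurableT_comp.
have mpxq : measurable_fun [set: X * Y] (fun z => px z.1 * q z.2).
  by apply: measurable_funM; [exact: m1|exact: m2].
have mpxy : measurable_fun [set: X * Y] (fun z => px z.1 * py z.2).
  by apply: measurable_funM; [exact: m1|exact: m2].
(* [A] is the relative entropy density with respect to [q], [r] comes from ln u <= u - 1, and [E]
   corrects the default values at [py = 0]. *)
pose A z := p z * ln (p z / (px z.1 * q z.2)).
pose r z := p z * (q z.2 / py z.2).
pose E z := (p z - A z) * (py z.2 == 0)%:R.
have mA : measurable_fun [set: X * Y] A by exact: measurable_mul_ln.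
have mqy : measurable_fun [set: Y] (fun y => q y / py y).
  by apply: measurable_funM => //; apply: measurableT_comp => //; exact: measurable_inv.
have mr : measurable_fun [set: X * Y] r.
  by apply: measurable_funM => //; exact: (m2 _ mqy).
pose Z (y : Y) : R := (py y == 0)%:R.
have mZ : measurable_fun [set: Y] Z.
  have -> : Z = \1_(py @^-1` [set 0]).
    apply/funext => y; rewrite /Z indicE; congr (nat_of_bool _)%:R.
    by apply/eqP/idP => [e|]; rewrite ?inE.
  apply: measurable_indic.
  by rewrite -[X in measurable X]setTI; apply: mpy => //; exact: measurable_set1.
have mE : measurable_fun [set: X * Y] E.
  by apply: measurable_funM; [exact: measurable_funB|exact: (m2 _ mZ)].
have ip : (\int[mu \x nu]_z (p z)%:E = 1)%E.
  rewrite (fubini_tonelli1 (EFin \o p))//=; last exact/measurable_EFinP.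
  by rewrite -px1; apply: eq_integral => x _; exact: ipx.
have ipxq : (\int[mu \x nu]_z (px z.1 * q z.2)%:E = 1)%E.
  rewrite (fubini_tonelli1 (fun z => (px z.1 * q z.2)%:E))//=; last 2 first.
  - exact/measurable_EFinP.
  - by move=> z; rewrite lee_fin mulr_ge0.
  rewrite -px1; apply: eq_integral => x _; rewrite /fubini_F /=.
  under eq_integral do rewrite EFinM.
  rewrite ge0_integralZl ?q1 ?mule1//; first exact/measurable_EFinP.
    by move=> y _; rewrite lee_fin.
  by rewrite lee_fin.
have irE y : (\int[mu]_x (r (x, y))%:E = (q y / py y * py y)%:E)%E.
  rewrite /r /=; under eq_integral do rewrite mulrC EFinM.
  rewrite ge0_integralZl// ?ipy ?EFinM// ?lee_fin ?divr_ge0//.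
  - by apply/measurable_EFinP; apply: (measurableT_comp mp).
  - by move=> x _; rewrite lee_fin.
have r0 z : 0 <= r z by rewrite mulr_ge0// divr_ge0.
(* Integrating over x first leaves [q y] where [py y != 0] and 0 elsewhere, hence an inequality. *)
have ir : (\int[mu \x nu]_z (r z)%:E <= 1)%E.
  rewrite (fubini_tonelli2 (EFin \o r))//=; last exact/measurable_EFinP.
  rewrite -q1 /fubini_G /=; under eq_integral do rewrite irE.
  apply: ge0_le_integral => //.
  - by move=> y _; rewrite lee_fin mulr_ge0// divr_ge0.
  - by apply/measurable_EFinP; apply: measurable_funM.
  - exact/measurable_EFinP.
  - move=> y _; rewrite lee_fin; have [->|y0] := eqVneq (py y) 0.
      by rewrite mulr0.
    by rewrite divfK.
have ge0_integrable (f : X * Y -> R) : measurable_fun [set: X * Y] f ->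
    (forall z, 0 <= f z) -> (\int[mu \x nu]_z (f z)%:E <= 1)%E ->
    (mu \x nu)%E.-integrable [set: X * Y] (EFin \o f).
  move=> mf f0 f1; apply/integrableP; split; first exact/measurable_EFinP.
  under eq_integral do rewrite /= ger0_norm//.
  by rewrite (le_lt_trans f1)// ltry.
have intp : (mu \x nu)%E.-integrable [set: X * Y] (EFin \o p).
  by apply: ge0_integrable => //; rewrite ip.
have intr := ge0_integrable _ mr r0 ir.
have intpxq : (mu \x nu)%E.-integrable [set: X * Y]
    (EFin \o (fun z => px z.1 * q z.2)).
  by apply: ge0_integrable => // [z|]; rewrite ?ipxq// mulr_ge0.
have intA : (mu \x nu)%E.-integrable [set: X * Y] (EFin \o A).
  have intg := integrableD measurableT intpxq (integrableZl measurableT `|ln C| intp).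
  apply: le_integrable intg => //; first exact/measurable_EFinP.
  move=> [x y] _ /=; rewrite lee_fin.
  have h0 : 0 <= px x * q y by rewrite mulr_ge0.
  have hC : 0 <= `|ln C| * p (x, y) by rewrite mulr_ge0.
  rewrite [leRHS]ger0_norm ?addr_ge0// ler_norml; apply/andP; split.
    by rewrite (le_trans _ (mul_ln_ge (p0 (x, y)) h0))// lerN2 lerDl.
  rewrite (le_trans (mul_ln_le (p0 (x, y)) h0 (pC x y)))//.
  by rewrite mulrC lerDr.
have intpA := integrableB measurableT intp intA.
have intE : (mu \x nu)%E.-integrable [set: X * Y] (EFin \o E).
  apply: le_integrable intpA => //; first exact/measurable_EFinP.
  move=> z _ /=; rewrite lee_fin normrM ler_piMr//.
  by case: eqP => _; rewrite ?normr1 ?normr0.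
(* For [py y = 0] the section of [p] at [y] has integral 0, so [p] vanishes almost everywhere on
   that set; and [E] vanishes wherever [p] does. *)
have E0 : (\int[mu \x nu]_z (E z)%:E = 0)%E.
  have mpZ : measurable_fun [set: X * Y] (fun z => p z * Z z.2).
    by apply: measurable_funM => //; exact: m2.
  have pZ0 z : 0 <= p z * Z z.2 by rewrite mulr_ge0// /Z ler0n.
  have ipZ : (\int[mu \x nu]_z `|(p z * Z z.2)%:E| = 0)%E.
    under eq_integral do rewrite /= ger0_norm//.
    rewrite (fubini_tonelli2 (fun z => (p z * Z z.2)%:E))//=; last first.
      exact/measurable_EFinP.
    rewrite /fubini_G /= integral0_eq// => y _.
    under eq_integral do rewrite mulrC EFinM.
    rewrite ge0_integralZl//; last 3 first.
    - by apply/measurable_EFinP; apply: (measurableT_comp mp).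
    - by move=> x _; rewrite lee_fin.
    - by rewrite lee_fin ler0n.
    by rewrite ipy -EFinM /Z; case: eqP => [->|_]; rewrite ?mulr0 ?mul0r.
  have := (ae_eq_integral_abs _ measurableT ((measurable_EFinP _ _).2 mpZ)).1 ipZ.
  move=> pZae; rewrite (ae_eq_integral (cst 0%E))//=.
  - by rewrite integral0.
  - exact/measurable_EFinP.
  apply: filterS pZae => z /= /(_ I) /eqP.
  rewrite eqe mulf_eq0 /Z /E /A => h _; congr EFin.
  by case/orP: h => /eqP ->; rewrite ?mulr0// !mul0r subrr mul0r.
have intAr := integrableD measurableT intA intr.
have intArp := integrableB measurableT intAr intp.
have intArpE := integrableD measurableT intArp intE.
apply: (@le_trans _ _ (\int[mu \x nu]_z ((A z)%:E + (r z)%:E - (p z)%:E + (E z)%:E))%E).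
  apply: le_integral_measurable => [||z].
  - by apply/measurable_EFinP; exact: measurable_mul_ln.
  - exact: measurable_int intArpE.
  - rewrite -!EFinD lee_fin -(addrA (A z)); apply: mul_ln_change => //.
    by case: z => x y; exact: pC.
rewrite (integralD measurableT intArp intE) (integralB measurableT intAr intp).
rewrite (integralD measurableT intA intr) /= E0 adde0 ip.
have iA : (\int[mu \x nu]_z (A z)%:E <= W%:E)%E.
  rewrite -(integral12_prod_meas1 intA) /=.
  have -> : W%:E = (\int[mu]_x (px x * W)%:E)%E.
    under eq_integral do rewrite mulrC EFinM.
    rewrite integralZl ?px1 ?mule1//; apply/integrableP; split.
      exact/measurable_EFinP.
    under eq_integral do rewrite /= ger0_norm//.
    by rewrite px1 ltry.
  apply: le_integral_measurable => [||x]; last exact: hW.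
  - exact: measurable_fubini_F intA.
  - by apply/measurable_EFinP; exact: measurable_funM.
by rewrite leeBlDr//; apply: leeD.
Qed.

(** * Positive semidefinite matrices: entries, traces and rank-one decompositions *)

Lemma psdmx_pair (R : realType) n (A : 'M[R[i]]_n) (i j : 'I_n) (c : R[i]) :
  psdmx A -> 0 <= A i i + c * A i j + conjc c * A j i + conjc c * c * A j j.
Proof.
move=> /(_ (delta_mx i 0 + c *: delta_mx j 0)).
have E (k l : 'I_n) : (delta_mx 0 k *m A *m delta_mx l 0 : 'M[R[i]]_1) 0 0 = A k l.
  by rewrite -rowE -colE !mxE.
rewrite [(_ + _)^T]raddfD /= [(c *: _)^T]linearZ /= !trmx_delta.
rewrite map_mxD map_mxZ !map_delta_mx.
rewrite !mulmxDl !mulmxDr -!scalemxAl -!scalemxAr.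
have Eadd (x y : 'M[R[i]]_1) : (x + y) 0 0 = x 0 0 + y 0 0 by rewrite mxE.
have Escale k (x : 'M[R[i]]_1) : (k *: x) 0 0 = k * x 0 0 by rewrite mxE.
rewrite !(Eadd, Escale, E); congr (0 <= _).
by rewrite -[conjc c]/(Num.conj c) mulrA; ring.
Qed.

(** Polarization: [psdmx_pair] is taken at [c] equal to 0, 1, -1, i and -i. That these values are
    real gives the Hermitian symmetry; that they are nonnegative gives the bounds. *)
Lemma psdmx_entry (R : realType) n (A : 'M[R[i]]_n) (i j : 'I_n) : psdmx A ->
  [/\ 0 <= complex.Re (A i i), complex.Im (A i i) = 0, A j i = conjc (A i j),
      `|complex.Re (A i j)| *+ 2 <= complex.Re (A i i) + complex.Re (A j j) &
      `|complex.Im (A i j)| *+ 2 <= complex.Re (A i i) + complex.Re (A j j)].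
Proof.
move=> Apsd.
have := psdmx_pair i j (1 +i* 0) Apsd; have := psdmx_pair i j (- 1 +i* 0) Apsd.
have := psdmx_pair i j (0 +i* 1) Apsd; have := psdmx_pair i j (0 +i* - 1) Apsd.
have := psdmx_pair i j 0 Apsd; have := psdmx_pair j i 0 Apsd.
rewrite !mulr0 !mul0r conjc0 !mul0r !addr0.
case: (A i i) (A i j) (A j i) (A j j) => [a a'] [b b'] [c c'] [e e'].
rewrite !lecE /= => /andP[/eqP H1 H2] /andP[/eqP H3 H4] /andP[/eqP H5 H6].
move=> /andP[/eqP H7 H8] /andP[/eqP H9 H10] /andP[/eqP H11 H12].
by split=> //; [congr Complex; lra| rewrite mulr2n; case: ger0P; lra..].
Qed.


Lemma psdmx_diag_ge0 (R : realType) n (A : 'M[R[i]]_n) (i : 'I_n) :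
  psdmx A -> 0 <= complex.Re (A i i).
Proof. by move=> /(psdmx_entry i i)[]. Qed.

Lemma Re_sum (R : realType) I (r : seq I) (P : pred I) (F : I -> R[i]) :
  complex.Re (\sum_(i <- r | P i) F i) = \sum_(i <- r | P i) complex.Re (F i).
Proof. by apply: (big_morph (@complex.Re R)) => // -[a b] [c d]. Qed.

Lemma Im_sum (R : realType) I (r : seq I) (P : pred I) (F : I -> R[i]) :
  complex.Im (\sum_(i <- r | P i) F i) = \sum_(i <- r | P i) complex.Im (F i).
Proof. by apply: (big_morph (@complex.Im R)) => // -[a b] [c d]. Qed.

Lemma ReM (R : realType) (x y : R[i]) : complex.Re (x * y) =
  complex.Re x * complex.Re y - complex.Im x * complex.Im y.
Proof. by case: x y => [a b] [c d]. Qed.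

Lemma psdmx_tr_ge0 (R : realType) n (A : 'M[R[i]]_n) :
  psdmx A -> 0 <= complex.Re (\tr A).
Proof. by move=> Ap; rewrite Re_sum sumr_ge0// => i _; exact: psdmx_diag_ge0. Qed.

Lemma psdmx_trE (R : realType) n (A : 'M[R[i]]_n) :
  psdmx A -> \tr A = (complex.Re (\tr A))%:C.
Proof.
move=> Ap; have : complex.Im (\tr A) = 0.
  by rewrite Im_sum big1// => i _; have [] := psdmx_entry i i Ap.
by case: (\tr A) => a b /= ->.
Qed.

Lemma psdmx_entry_le_tr (R : realType) n (A : 'M[R[i]]_n) (i j : 'I_n) :
  psdmx A -> `|complex.Re (A i j)| <= complex.Re (\tr A) /\
             `|complex.Im (A i j)| <= complex.Re (\tr A).
Proof.
move=> Ap; have le_tr k : complex.Re (A k k) <= complex.Re (\tr A).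
  rewrite Re_sum (bigD1 k)//= lerDl sumr_ge0// => l _; exact: psdmx_diag_ge0.
have [_ _ _ hRe hIm] := psdmx_entry i j Ap.
by have := le_tr i; have := le_tr j; rewrite !mulr2n in hRe hIm; split; lra.
Qed.

(** Each of the n^2 products of entries has real part at most twice the product of the traces, the 2
    coming from real and imaginary parts. The purpose is qualitative: domination for integrability,
    and absolute continuity. *)
Lemma psdmx_mul_tr_le (R : realType) n (A B : 'M[R[i]]_n) :
  psdmx A -> psdmx B -> complex.Re (\tr (A *m B)) <=
    (n ^ 2)%:R * 2 * (complex.Re (\tr A) * complex.Re (\tr B)).
Proof.
move=> Ap Bp; set a := complex.Re (\tr A); set b := complex.Re (\tr B).
have h i j : complex.Re (A i j * B j i) <= 2 * (a * b).
  have [RA IA] := psdmx_entry_le_tr i j Ap.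
  have [RB IB] := psdmx_entry_le_tr j i Bp.
  rewrite ReM (le_trans (ler_norm _))// (le_trans (ler_normB _ _))// !normrM.
  by rewrite mulr2n mulrDl mul1r lerD// ler_pM.
rewrite Re_sum.
under eq_bigr do rewrite mxE Re_sum.
rewrite (le_trans (ler_sum _ (fun i _ => ler_sum _ (fun j _ => h i j))))//.
by rewrite !sumr_const !card_ord -mulrnA mulnn -[leLHS]mulr_natl -[leRHS]mulrA.
Qed.

Lemma psdmx_hermitian (R : realType) n (A : 'M[R[i]]_n) :
  psdmx A -> A \is hermsymmx.
Proof.
move=> Ap; rewrite is_hermitianmxE expr0 scale1r; apply/eqP/matrixP => i j.
by rewrite !mxE; have [_ _ -> _ _] := psdmx_entry j i Ap.
Qed.

Lemma qform_row (R : realType) m n (X : 'M[R[i]]_(m, n)) (B : 'M[R[i]]_n) (i : 'I_m) :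
  (X *m B *m X ^t*) i i = qform B ((row i X) ^t*).
Proof.
rewrite trmxCK -row_mul !mxE; apply: eq_bigr => j _.
by rewrite !mxE.
Qed.

(** By the spectral theorem [A = V ^t* *m V]; the vectors are the conjugate transposed rows of [V],
    so that [A] is a sum of unnormalised pure states. *)
Lemma psdmx_tr_mul_sum (R : realType) n (A : 'M[R[i]]_n) : psdmx A ->
  exists w : 'I_n -> 'cV[R[i]]_n,
    forall B : 'M[R[i]]_n, \tr (A *m B) = \sum_i qform B (w i).
Proof.
move=> Ap; have An := hermitian_normalmx (psdmx_hermitian Ap).
have /orthomx_spectralP EA := An.
set P := spectralmx A in EA; set sp := spectral_diag A in EA.
have PU : P \is unitarymx := spectral_unitarymx A.
(* Eigenvalues are values of the quadratic form at eigenvectors, hence nonnegative. *)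
have spE i : sp 0 i = qform A ((row i P) ^t*).
  rewrite -qform_row {1}EA -/P invmx_unitary// !mulmxA (unitarymxP PU) mul1mx.
  by rewrite -mulmxA (unitarymxP PU) mulmx1 mxE eqxx.
have sp0 i : 0 <= sp 0 i by rewrite spE.
pose V := diag_mx (map_mx sqrtC sp) *m P.
exists (fun i => (row i V) ^t*) => B.
have -> : A = V ^t* *m V.
  rewrite EA /V trmx_mul map_mxM invmx_unitary// !mulmxA; congr (_ *m P).
  rewrite -mulmxA; congr (_ *m _).
  rewrite tr_diag_mx map_diag_mx mulmx_diag; congr diag_mx.
  apply/rowP => i; rewrite !mxE.
  have s0 : 0 <= sqrtC (sp 0 i) by rewrite sqrtC_ge0.
  apply/esym; apply: (etrans (congr1 (fun z => z * _) (geC0_conj s0))).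
  by rewrite -expr2 sqrtCK.
rewrite -mulmxA mxtrace_mulC; apply: eq_bigr => i _.
by rewrite -qform_row.
Qed.

Lemma psdmx1 (R : realType) d : psdmx (1%:M : 'M[R[i]]_d).
Proof.
by move=> w; rewrite mulmx1 mxE sumr_ge0// => j _; rewrite !mxE mulrC mul_conjC_ge0.
Qed.

(** * Tensor powers of vectors and the symmetric subspace *)

Definition tens_cv {C : comPzRingType} {d : nat} (k : nat) (v : 'cV[C]_d) :
    'cV[C]_(tens_dim k d) :=
  \col_a \prod_(i < k) v (tens_idx a i) 0.

Lemma sum_tens_idx (C : comPzRingType) d k (F : 'I_k -> 'I_d -> C) :
  \sum_(a < tens_dim k d) \prod_(i < k) F i (tens_idx a i) =
  \prod_(i < k) \sum_(j < d) F i j.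
Proof.
rewrite bigA_distr_bigA /= (reindex (@enum_rank {ffun 'I_k -> 'I_d})) /=.
  by apply: eq_bigr => a _; rewrite /tens_idx enum_rankK.
by apply: onW_bij; exact: enum_rank_bij.
Qed.

Lemma tens_cv_dot (C : comPzRingType) d k (u v : 'cV[C]_d) :
  ((tens_cv k u)^T *m tens_cv k v) 0 0 = ((u^T *m v) 0 0) ^+ k.
Proof.
rewrite mxE; under eq_bigr do rewrite !mxE -big_split /=.
rewrite (sum_tens_idx (fun _ j => u j 0 * v j 0)) prodr_const card_ord.
by rewrite mxE; congr (_ ^+ _); apply: eq_bigr => j _; rewrite mxE.
Qed.

Lemma tens_powmx_cv (C : comPzRingType) d k (A : 'M[C]_d) (v : 'cV[C]_d) :
  tens_powmx k A *m tens_cv k v = tens_cv k (A *m v).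
Proof.
apply/matrixP => a j; rewrite !mxE.
under eq_bigr do rewrite !mxE -big_split /=.
rewrite (sum_tens_idx (fun i j => A (tens_idx a i) j * v j 0)).
by apply: eq_bigr => i _; rewrite mxE.
Qed.

Lemma tens_cv_perm (C : comPzRingType) d k (s : 'S_k) (v : 'cV[C]_d) :
  (tens_cv k v)^T *m tens_permmx d s = (tens_cv k v)^T.
Proof.
apply/matrixP => i b; rewrite !mxE.
(* Column [b] of the permutation matrix has its only nonzero entry in row [a0]. *)
pose a0 : 'I_(tens_dim k d) := enum_rank [ffun i => tens_idx b (s^-1%g i)].
rewrite (bigD1 a0)//= big1 ?addr0 => [|a aN]; last first.
  rewrite !mxE; case: eqP => [E|]; last by rewrite mulr0.
  case/eqP: aN; rewrite /a0 E; apply: enum_val_inj; rewrite enum_rankK.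
  by apply/ffunP => j; rewrite !ffunE permKV.
rewrite !mxE /tens_idx enum_rankK; case: eqP => [_|[]]; last first.
  by apply/ffunP => j; rewrite !ffunE permK.
rewrite mulr1 [RHS](reindex_inj (@perm_inj _ s^-1%g)) /=.
by apply: eq_bigr => j _; rewrite ffunE.
Qed.

Lemma tens_cv_Psym (C : numClosedFieldType) d k (v : 'cV[C]_d) :
  (tens_cv k v)^T *m Psym k d = (tens_cv k v)^T.
Proof.
apply: proj_ortho_id; apply/sub_bigcapmxP => s _.
by apply/eigenspaceP; rewrite scale1r tens_cv_perm.
Qed.

(** * Integrals of matrix functions and moments of a design *)

Lemma has_mx_integral_tr (R : realType) n
    (F : measurableTypeR R -> 'M[R[i]]_n) (M B : 'M[R[i]]_n) :
  has_mx_integral F M ->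
  lebesgue_measure.-integrable setT
    (fun y => (complex.Re (\tr (B *m F y)))%:E) /\
  (\int[lebesgue_measure]_y (complex.Re (\tr (B *m F y)))%:E =
   (complex.Re (\tr (B *m M)))%:E)%E.
Proof.
move=> FM.
pose G i j y : \bar R := ((complex.Re (B i j))%:E * (complex.Re (F y j i))%:E
  - (complex.Im (B i j))%:E * (complex.Im (F y j i))%:E)%E.
have EG y : (complex.Re (\tr (B *m F y)))%:E = (\sum_i \sum_j G i j y)%E.
  rewrite Re_sum -sumEFin; apply: eq_bigr => i _.
  by rewrite mxE Re_sum -sumEFin; apply: eq_bigr => j _; rewrite ReM.
have iRe i j : lebesgue_measure.-integrable setT
    (fun y => (complex.Re (B i j))%:E * (complex.Re (F y j i))%:E)%E.
  by apply: integrableZl => //; have [] := FM j i.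
have iIm i j : lebesgue_measure.-integrable setT
    (fun y => (complex.Im (B i j))%:E * (complex.Im (F y j i))%:E)%E.
  by apply: integrableZl => //; have [] := FM j i.
have iG i j : lebesgue_measure.-integrable setT (G i j).
  exact: integrableB (iRe i j) (iIm i j).
have iGs i : lebesgue_measure.-integrable setT (fun y => \sum_j G i j y)%E.
  exact: integrable_sum.
rewrite (funext EG).
split; first exact: integrable_sum.
rewrite integral_sum// Re_sum -sumEFin; apply: eq_bigr => i _.
rewrite integral_sum// mxE Re_sum -sumEFin; apply: eq_bigr => j _.
have [rF iF ->] := FM j i.
rewrite integralB// !integralZl// ReM EFinB !EFinM /Rintegral.
by rewrite !fineK//; exact: integrable_fin_num.
Qed.

Lemma qform_trE (R : realType) d (B : 'M[R[i]]_d) (v : 'cV[R[i]]_d) :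
  qform B v = \tr (v *m v ^t* *m B).
Proof. by rewrite -[in RHS]mulmxA mxtrace_mulC [RHS]trace_mx11. Qed.

Lemma psdmx_outer (R : realType) d (v : 'cV[R[i]]_d) : psdmx (v *m v ^t*).
Proof.
move=> w; rewrite !mulmxA.
have -> : w ^t* *m v *m v ^t* *m w = (w ^t* *m v) *m (w ^t* *m v) ^t*.
  by rewrite trmx_mul map_mxM trmxCK !mulmxA.
by rewrite mxE big_ord1 !mxE; exact: mul_conjC_ge0.
Qed.

Lemma qform_le (R : realType) d (B : 'M[R[i]]_d) (v : 'cV[R[i]]_d) :
  psdmx B -> complex.Re (qform B v) <=
    (d ^ 2)%:R * 2 * (complex.Re ((v ^t* *m v) 0 0) * complex.Re (\tr B)).
Proof.
move=> Bp; rewrite qform_trE.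
rewrite (le_trans (psdmx_mul_tr_le (psdmx_outer v) Bp))//.
by rewrite mxtrace_mulC trace_mx11.
Qed.

Lemma qform_ge0 (R : realType) d (B : 'M[R[i]]_d) (v : 'cV[R[i]]_d) :
  psdmx B -> qform B v = (complex.Re (qform B v))%:C /\ 0 <= complex.Re (qform B v).
Proof.
by move=> /(_ v); rewrite lecE; case: (qform B v) => a b /= /andP[/eqP -> ->].
Qed.

(** The design identity is paired with the rank-one operator of the k-th tensor power of [v]. That
    vector is fixed by [Psym], and tensor powers turn quadratic forms into their powers. As [v] is
    unnormalised, a power of its squared norm appears. *)
Lemma design_moment (R : realType) d t (pi : measurableTypeR R -> 'M[R[i]]_d)
    (v : 'cV[R[i]]_d) (k : nat) : is_design_povm t pi -> (0 < k <= t)%N ->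
  let f y := complex.Re (qform (pi y) v) ^+ k / complex.Re (\tr (pi y)) ^+ k.-1 in
  lebesgue_measure.-integrable setT (fun y => (f y)%:E) /\
  (\int[lebesgue_measure]_y (f y)%:E =
   (d%:R / 'C(d.-1 + k, k)%:R * complex.Re ((v ^t* *m v) 0 0) ^+ k)%:E)%E.
Proof.
move=> [[_ pi_eff _] pi_des] kt f.
(* The lemmas on [tens_cv] use plain transposes, so the adjoint of the tensor power of [v] is the
   transpose of that of [vc]. *)
pose vc := map_mx Num.conj v.
have vcT : vc^T = v ^t* by rewrite map_trmx.
have [] := has_mx_integral_tr (tens_cv k v *m (tens_cv k vc)^T) (pi_des k kt).
have trE (M : 'M[R[i]]_(tens_dim k d)) : \tr (tens_cv k v *m (tens_cv k vc)^T *m M)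
    = ((tens_cv k vc)^T *m M *m tens_cv k v) 0 0.
  by rewrite -mulmxA mxtrace_mulC trace_mx11.
have FE y : complex.Re (\tr (tens_cv k v *m (tens_cv k vc)^T *m
    ((\tr (pi y) ^+ k.-1)^-1 *: tens_powmx k (pi y)))) = f y.
  have [Ep Ep'] := pi_eff y.
  rewrite trE -scalemxAr -scalemxAl mxE -mulmxA tens_powmx_cv tens_cv_dot vcT mulmxA.
  rewrite (qform_ge0 v Ep).1 (psdmx_trE Ep).
  rewrite -rmorphXn -fmorphV -rmorphXn -rmorphM /=.
  by rewrite /f mulrC.
rewrite (funext (fun y => congr1 EFin (FE y))) => intf ->; split=> //; congr (_%:E).
rewrite trE -scalemxAr -scalemxAl mxE tens_cv_Psym tens_cv_dot vcT.
have := (qform_ge0 v (@psdmx1 R d)).1; rewrite mulmx1 => ->.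
rewrite -rmorphXn -!(rmorph_nat (real_complex R)) -fmorphV -!rmorphM /=.
by [].
Qed.

(** Both sides are homogeneous of degree 1 in [A], so [A] and its rank-one components are kept
    unnormalised. The log-sum inequality passes to the components, where the cubic bound is
    integrated term by term. *)
Lemma design_information_le (R : realType) d
    (pi : measurableTypeR R -> 'M[R[i]]_d) (A : 'M[R[i]]_d) : (0 < d)%N ->
  is_design_povm 4 pi -> psdmx A ->
  (\int[lebesgue_measure]_y
     (complex.Re (\tr (A *m pi y)) * ln (complex.Re (\tr (A *m pi y)) /
       (complex.Re (\tr A) * (complex.Re (\tr (pi y)) / d%:R))))%:E
   <= (complex.Re (\tr A) * W4 R d)%:E)%E.
Proof.
move=> d0 pi_des Ap; pose p y := complex.Re (\tr (A *m pi y)).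
have [[_ pi_eff pi_int] _] := pi_des.
have pi_psd y : psdmx (pi y) by have [] := pi_eff y.
have [h [ln_h h_W4]] := ln_le_cubic R d0.
have [w wE] := psdmx_tr_mul_sum Ap.
pose a i y := complex.Re (qform (pi y) (w i)).
pose b i := complex.Re ((w i ^t* *m w i) 0 0).
pose T y := complex.Re (\tr (pi y)).
have T0 y : 0 <= T y by exact: psdmx_tr_ge0.
have pE y : p y = \sum_i a i y by rewrite /p wE Re_sum.
have trA : complex.Re (\tr A) = \sum_i b i.
  rewrite -[A in LHS]mulmx1 wE Re_sum; apply: eq_bigr => i _.
  by rewrite /b mulmx1.
have a0 i y : 0 <= a i y by exact: (qform_ge0 _ (pi_psd y)).2.
have b0 i : 0 <= b i.
  by have := (qform_ge0 (w i) (@psdmx1 R d)).2; rewrite mulmx1.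
have aC i y : a i y <= (d ^ 2)%:R * 2 * (b i * T y) by exact: qform_le.
have ab i y : b i = 0 -> a i y = 0.
  by move=> bi; apply: le_anti; rewrite a0 andbT (le_trans (aC i y))// bi mul0r mulr0.
(* With t = a_i(y) / (b_i T(y)), this is the term a_i(y) h_k t^k of the cubic bound; the power
   [k.+1] of [a i y] is at most 4, as the design allows. *)
pose g i (k : 'I_4) y := h k * (b i) ^- k * (a i y ^+ k.+1 / T y ^+ k).
have mom (k : 'I_4) : (0 < k.+1 <= 4)%N by rewrite ltn_ord.
have ig i k : lebesgue_measure.-integrable setT (fun y => (g i k y)%:E).
  have [intm _] := design_moment (w i) pi_des (mom k).
  exact: (integrableZl measurableT (h k * (b i) ^- k) intm).
have gE i k : (\int[lebesgue_measure]_y (g i k y)%:E =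
    (h k * (d%:R / 'C(d.-1 + k.+1, k.+1)%:R) * b i)%:E)%E.
  have [intm im] := design_moment (w i) pi_des (mom k).
  under eq_integral do rewrite EFinM.
  rewrite integralZl// im -EFinM -/(b i); congr (_%:E).
  have [->|bi] := eqVneq (b i) 0; first by rewrite exprS mul0r !mulr0.
  move: (_ / 'C(_, _)%:R) => c; rewrite exprS.
  have : b i ^+ k != 0 by rewrite expf_neq0.
  by move: (b i ^+ k) => e e0; field.
have ag i y : a i y * ln (a i y / (b i * (T y / d%:R))) <= \sum_k g i k y.
  have := a0 i y; rewrite le_eqVlt => /predU1P[ai|ai].
    by rewrite -ai mul0r big1// => k _; rewrite /g -ai expr0n mul0r mulr0.
  have bT : 0 < b i * T y.
    rewrite lt_def mulr_ge0// andbT; apply: contraTneq (aC i y) => ->.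
    by rewrite mulr0 -ltNge.
  have bi : b i != 0 by apply: contraTneq bT => ->; rewrite mul0r ltxx.
  have Ti : T y != 0 by apply: contraTneq bT => ->; rewrite mulr0 ltxx.
  have dn0 : d%:R != 0 :> R by rewrite pnatr_eq0 -lt0n.
  have -> : a i y / (b i * (T y / d%:R)) = d%:R * (a i y / (b i * T y)).
    by field; rewrite bi Ti dn0.
  rewrite (le_trans (ler_wpM2l (ltW ai) (ln_h _ (divr_gt0 ai bT))))//.
  rewrite mulr_sumr ler_sum// => k _; rewrite /g exprS expr_div_n exprMn invfM.
  by rewrite le_eqVlt; apply/orP; left; apply/eqP; ring.
have iG i : lebesgue_measure.-integrable setT (fun y => (\sum_k (g i k y)%:E)%E).
  exact: integrable_sum.
apply: (@le_trans _ _ (\int[lebesgue_measure]_y (\sum_i \sum_k (g i k y)%:E))%E).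
  apply: le_integral_measurable => [||y].
  - apply/measurable_EFinP; apply: measurable_mul_ln.
      by have [/measurable_int/measurable_EFinP] := has_mx_integral_tr A pi_int.
    apply: measurable_funM => //; apply: measurable_funM => //.
    have [/measurable_int/measurable_EFinP + _] := has_mx_integral_tr 1%:M pi_int.
    by under eq_fun do rewrite mul1mx.
  - by apply: emeasurable_sum => i; exact: measurable_int (iG i).
  - under eq_bigr do rewrite sumEFin.
    rewrite sumEFin lee_fin -/(p y) trA pE.
    apply: le_trans (ler_sum _ (fun i _ => ag i y)).
    apply: log_sum => [i|i||i]; [exact: a0|exact: b0| |exact: ab].
    exact: divr_ge0 (T0 y) (ler0n _ _).
rewrite integral_sum//.
under eq_bigr do [rewrite integral_sum//; under eq_bigr do rewrite gE].
under eq_bigr do rewrite sumEFin.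
by rewrite sumEFin lee_fin trA -h_W4 mulr_suml; apply: ler_sum => i _;
  rewrite mulr_sumr ler_sum// => k _; rewrite mulrC.
Qed.

(** * Ensembles and the informational power *)

Lemma ensemble_integral (R : realType) d (rho : measurableTypeR R -> 'M[R[i]]_d) :
  is_ensemble rho -> exists sigma, has_mx_integral rho sigma.
Proof.
move=> [rho_meas rho_state rho1].
have rho_psd x : psdmx (rho x) by have [] := rho_state x.
have mtr : measurable_fun setT (fun x => complex.Re (\tr (rho x))).
  rewrite (_ : (fun _ => _) = fun x => \sum_i complex.Re (rho x i i)).
    by apply: measurable_sum => i; have [] := rho_meas i i.
  by apply/funext => x; rewrite Re_sum.
(* The trace, of total integral 1, dominates every entry of [rho x]. *)
have itr : lebesgue_measure.-integrable setT
    (fun x => (complex.Re (\tr (rho x)))%:E).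
  apply/integrableP; split; first exact/measurable_EFinP.
  under eq_integral => x _ do rewrite /= ger0_norm ?psdmx_tr_ge0//.
  by rewrite rho1 ltry.
exists (\matrix_(i, j)
  (Rintegral lebesgue_measure setT (fun x => complex.Re (rho x i j)) +i*
   Rintegral lebesgue_measure setT (fun x => complex.Im (rho x i j)))) => i j.
have [mRe mIm] := rho_meas i j.
split; last by rewrite mxE.
- apply: le_integrable itr => //; first exact/measurable_EFinP.
  move=> x _ /=; rewrite lee_fin [leRHS]ger0_norm ?psdmx_tr_ge0//.
  by have [] := psdmx_entry_le_tr i j (rho_psd x).
- apply: le_integrable itr => //; first exact/measurable_EFinP.
  move=> x _ /=; rewrite lee_fin [leRHS]ger0_norm ?psdmx_tr_ge0//.
  by have [] := psdmx_entry_le_tr i j (rho_psd x).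
Qed.

Theorem corollary4 (R : realType) (d : nat) (hd : (0 < d)%N)
    (pi : measurableTypeR R -> 'M[R[i]]_d) (hpi : is_design_povm 4 pi) :
  (informational_power pi <= (W4 R d)%:E)%E.
Proof.
apply: ge_ereal_sup => _ [rho rho_ens <-].
have [[pi_meas pi_eff pi_int] _] := hpi.
have [rho_meas rho_state rho1] := rho_ens.
have pi_psd y : psdmx (pi y) by have [] := pi_eff y.
have rho_psd x : psdmx (rho x) by have [] := rho_state x.
(* [sigma] is the average state: it expresses the marginal of y as Tr[pi_y sigma], a finite and
   measurable function. *)
have [sigma rho_int] := ensemble_integral rho_ens.
have ipx x : (\int[lebesgue_measure]_y (joint_prob rho pi x y)%:E =
    (complex.Re (\tr (rho x)))%:E)%E.
  by rewrite /joint_prob (has_mx_integral_tr (rho x) pi_int).2 mulmx1.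
have ipy y : (\int[lebesgue_measure]_x (joint_prob rho pi x y)%:E =
    (complex.Re (\tr (pi y *m sigma)))%:E)%E.
  rewrite -(has_mx_integral_tr (pi y) rho_int).2.
  by apply: eq_integral => x _; rewrite /joint_prob mxtrace_mulC.
have pxE x : marginal_x rho pi x = complex.Re (\tr (rho x)).
  by rewrite /marginal_x /Rintegral ipx.
have pyE y : marginal_y rho pi y = complex.Re (\tr (pi y *m sigma)).
  by rewrite /marginal_y /Rintegral ipy.
(* This is the outcome density of [pi] on the maximally mixed state; it has mass 1 since the
   identity has trace d. *)
pose q y := complex.Re (\tr (pi y)) / d%:R.
have dn0 : d%:R != 0 :> R by rewrite pnatr_eq0 -lt0n.
have tr_meas (F : measurableTypeR R -> 'M[R[i]]_d) (B M : 'M[R[i]]_d) :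
    has_mx_integral F M -> measurable_fun setT (fun x => complex.Re (\tr (B *m F x))).
  by move=> /(has_mx_integral_tr B)[/measurable_int/measurable_EFinP].
have tr1_meas (F : measurableTypeR R -> 'M[R[i]]_d) (M : 'M[R[i]]_d) :
    has_mx_integral F M -> measurable_fun setT (fun x => complex.Re (\tr (F x))).
  by move=> /(tr_meas _ 1%:M); under eq_fun do rewrite mul1mx.
(* In the constant, the last factor [d%:R] cancels the denominator of [q]; the rest comes from
   [psdmx_mul_tr_le]. *)
apply: (@mutual_information_le _ _ _ _ _ _ _
  (fun z => joint_prob rho pi z.1 z.2) _ _ q ((d ^ 2)%:R * 2 * d%:R)).
- rewrite (_ : (fun _ => _) = fun z : measurableTypeR R * measurableTypeR R =>
    \sum_i \sum_j (complex.Re (rho z.1 i j) * complex.Re (pi z.2 j i)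
                   - complex.Im (rho z.1 i j) * complex.Im (pi z.2 j i))).
    apply: measurable_sum => i; apply: measurable_sum => j.
    have [mR mI] := rho_meas i j; have [mR' mI'] := pi_meas j i.
    apply: measurable_funB; apply: measurable_funM.
    + exact: (measurableT_comp mR).
    + exact: (measurableT_comp mR').
    + exact: (measurableT_comp mI).
    + exact: (measurableT_comp mI').
  apply/funext => z; rewrite /joint_prob Re_sum; apply: eq_bigr => i _.
  by rewrite mxE Re_sum; apply: eq_bigr => j _; rewrite ReM.
- by rewrite (funext pxE); exact: tr1_meas rho_int.
- rewrite (funext pyE); under eq_fun do rewrite mxtrace_mulC.
  exact: tr_meas pi_int.
- by apply: measurable_funM => //; exact: tr1_meas pi_int.
- move=> z; have [w wE] := psdmx_tr_mul_sum (rho_psd z.1).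
  rewrite /joint_prob wE Re_sum sumr_ge0// => i _.
  exact: (qform_ge0 _ (pi_psd _)).2.
- by move=> y; rewrite divr_ge0// psdmx_tr_ge0.
- by rewrite (funext pxE).
- have [intq iq] := has_mx_integral_tr 1%:M pi_int.
  rewrite (_ : (fun _ => _) = fun y =>
    ((d%:R^-1)%:E * (complex.Re (\tr (1%:M *m pi y)))%:E)%E).
    rewrite integralZl// iq mul1mx mxtrace1 -(rmorph_nat (real_complex R)) /=.
    by rewrite -EFinM mulVf.
  by apply/funext => y; rewrite mul1mx -EFinM mulrC.
- by move=> x; rewrite pxE; exact: ipx.
- by move=> y; rewrite pyE; exact: ipy.
- move=> x y /=; rewrite pxE /q.
  rewrite (le_trans (psdmx_mul_tr_le (rho_psd x) (pi_psd y)))//.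
  by rewrite -[leRHS]mulrA (mulrCA d%:R) (mulrCA d%:R) divff// mulr1.
- move=> x /=; rewrite pxE; exact: design_information_le.
Qed.
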